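(* Let $\mathcal{A}$ be a unital C$^*$-algebra and let $a\in G^+$. Then $$\pi(P_a)=\pi(Q\cap\mathcal{U}_a)=P .$$ Therefore $\pi|_{P_a}:P_a\to P$ is a homeomorphism.
   Context: For a unital C$^*$-algebra $\mathcal{A}$ with involution $*$: $G$ is the group of invertible elements of $\mathcal{A}$, $\mathcal{U}=\{u\in G: u^*=u^{-1}\}$ is the unitary group, and $G^+$ is the set of positive invertible elements. $Q=\{\varepsilon\in G:\varepsilon^2=1\}$ is the space of reflections and $P=Q\cap\mathcal{U}=\{\rho\in G:\rho=\rho^*=\rho^{-1}\}$ the space of orthogonal reflections. The subsets of $\mathcal{A}$ carry the norm topology. The map $\pi:G\to\mathcal{U}$ assigns to each $g\in G$ its unitary part in the polar decomposition: $\pi(g)=(gg^* )^{-1/2}g=g(g^*g)^{-1/2}$. For $a\in G^+$, put $x^{\#_a}=a^{-1}x^*a$ for $x\in\mathcal{A}$, $\mathcal{U}_a=\{g\in G: g^{\#_a}=g^{-1}\}$, and $P_a=\{\varepsilon\in Q:\varepsilon=\varepsilon^{\#_a}=\varepsilon^{-1}\}=Q\cap\mathcal{U}_a$. *)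

(* Defs.v *)
From HB Require Import structures.
From mathcomp Require Import all_boot all_order all_algebra.
From mathcomp Require Import complex.
From mathcomp Require Import all_classical all_reals all_analysis.

Set Implicit Arguments.
Unset Strict Implicit.
Unset Printing Implicit Defensive.

Import Order.TTheory GRing.Theory Num.Theory.
Import numFieldNormedType.Exports.

Local Open Scope classical_set_scope.
Local Open Scope ring_scope.
Local Open Scope complex_scope.

(* In MathComp a type that is both a ring and a normed Z-module is inferred to
   be a [numDomainType], so an algebra cannot also be a [normedModType]: the
   norm [cnorm] is a separate operation and the norm topology is carried by
   the alias [normed_space A] of A. As for a [normedModType R[i]], the norm has
   values in R[i]; they are real and nonnegative, since 0 <= z in R[i] means
   that z is real and nonnegative. *)
HB.mixin Record isNormedUnitAlgebra (R : realType) A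
    & GRing.UnitAlgebra R[i] A := {
  cnorm : A -> R[i];
  cnormD : forall x y : A, cnorm (x + y) <= cnorm x + cnorm y;
  cnormZ : forall (z : R[i]) (x : A), cnorm (z *: x) = `|z| * cnorm x;
  cnorm0_eq0 : forall x : A, cnorm x = 0 -> x = 0;
  cnormM : forall x y : A, cnorm (x * y) <= cnorm x * cnorm y
}.

#[short(type="normedUnitAlgType")]
HB.structure Definition NormedUnitAlgebra (R : realType) :=
  { A of isNormedUnitAlgebra R A & GRing.UnitAlgebra R[i] A }.

Definition normed_space (R : realType) (A : normedUnitAlgType R) : Type := A.

HB.instance Definition _ (R : realType) (A : normedUnitAlgType R) :=
  GRing.Lmodule.copy (normed_space A) A.

HB.instance Definition _ (R : realType) (A : normedUnitAlgType R) :=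
  Lmodule_isNormed.Build R[i] (normed_space A)
    (@cnormD R A) (@cnormZ R A) (@cnorm0_eq0 R A).

(* [cnorm_complete] is the completeness axiom of [completeNormedModType]. *)
HB.mixin Record isCStarAlgebra (R : realType) A & NormedUnitAlgebra R A := {
  star : A -> A;
  starK : involutive star;
  starD : {morph star : x y / x + y};
  starZ : forall (z : R[i]) (x : A), star (z *: x) = Num.conj z *: star x;
  starM : forall x y : A, star (x * y) = star y * star x;
  cnorm_star : forall x : A, cnorm (star x * x) = cnorm x ^+ 2;
  cnorm_complete : forall F : set_system (normed_space A),
    ProperFilter F -> cauchy F -> cvg F
}.

#[short(type="cstarAlgType")]
HB.structure Definition CStarAlgebra (R : realType) :=
  { A of isCStarAlgebra R A & NormedUnitAlgebra R A }.

HB.instance Definition _ (R : realType) (A : cstarAlgType R) :=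
  Uniform_isComplete.Build (normed_space A) (@cnorm_complete R A).

Section CStarAlgebraSets.
Context {R : realType} {A : cstarAlgType R}.
Implicit Types (a g x : A) (z : R[i]).

Definition spectrum x : set R[i] := [set z | x - z%:A \isn't a GRing.unit].

Definition positive x : Prop :=
  star x = x /\ spectrum x `<=` [set z | 0 <= z].

Definition posInvertible : set A := [set x | x \is a GRing.unit /\ positive x].

(* The positive square root, chosen classically; 0 if there is none. *)
Definition cstar_sqrt x : A := xget 0 [set y | positive y /\ y ^+ 2 = x].

Definition polarUnitary g : A := (cstar_sqrt (g * star g))^-1 * g.

Definition unitaries : set A :=
  [set u | u \is a GRing.unit /\ star u = u^-1].

Definition reflections : set A :=
  [set e | e \is a GRing.unit /\ e ^+ 2 = 1].

Definition orthReflections : set A := reflections `&` unitaries.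

Definition sharp a x : A := a^-1 * star x * a.

Definition unitariesOf a : set A :=
  [set g | g \is a GRing.unit /\ sharp a g = g^-1].

Definition orthReflectionsOf a : set A :=
  [set e | [/\ reflections e, e = sharp a e & sharp a e = e^-1]].

End CStarAlgebraSets.

Arguments posInvertible {R} A.
Arguments unitaries {R} A.
Arguments reflections {R} A.
Arguments orthReflections {R} A.

(* f restricts to a homeomorphism from X onto Y for the subspace topologies. *)
Definition homeomorphism_on (T U : topologicalType) (X : set T) (Y : set U)
    (f : T -> U) : Prop :=
  [/\ set_bij X Y f, {within X, continuous f} &
      exists g : U -> T,
        [/\ {in X, cancel f g}, {in Y, cancel g f} &
            {within Y, continuous g}]].

(* Main.v *)
Require Import Defs.
From HB Require Import structures.
From mathcomp Require Import all_boot all_order all_algebra.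
From mathcomp Require Import complex.
From mathcomp Require Import all_classical all_reals all_analysis.
From mathcomp Require Import ring lra.

Set Implicit Arguments.
Unset Strict Implicit.
Unset Printing Implicit Defensive.

Import Order.TTheory GRing.Theory Num.Theory.
Import numFieldNormedType.Exports.

Local Open Scope classical_set_scope.
Local Open Scope ring_scope.

(** Every step happens inside the set of positive invertible elements, and the
    theory of that set is obtained from the C*-identity and from fixed points of
    contractions alone; no functional calculus or Gelfand transform occurs.

    Positive invertible elements.  Call x strictly positive ([spos]) when it is
    selfadjoint and ||t - x|| < t for some real t.  Such elements obviously form
    an open convex cone of invertible elements, and the equation s^2 = x can be
    solved in it by a contraction, with s in the bicommutant of x ([spos_sqrt]).
    For commuting selfadjoint a, b the element a + ib is normal and
    (a + ib)^* (a + ib) = a^2 + b^2, so the C*-identity gives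
    ||a^2|| <= ||a^2 + b^2||; together with square roots this shows that the
    square of an invertible selfadjoint element is strictly positive
    ([spos_sqr_unit]) and that selfadjoint elements have real spectrum
    ([unit_sub_nonreal]).  Sliding x + l down from large l to l = 0 then proves
    that an invertible x with spectrum in [0, +oo) is strictly positive
    ([posInvertible_spos]), so [spos] is the same as [posInvertible].
    Consequences: positive square roots are unique ([spos_sqrt_uniq]), and
    g p g is strictly positive when p is and g is selfadjoint and invertible
    ([spos_conj]).

    The bijection.  Let b be the positive square root of a.  For e in P_a the
    element f = b e b^-1 is selfadjoint, and e e^* = b^-1 (f a f) b^-1 is strictly
    positive, so e = s v with s = (e e^* )^(1/2) and v = pi(e) unitary.  Since
    e = e^-1 = (v^* s^-1 v) v^*, uniqueness of the square root of e e^* gives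
    s = v^* s^-1 v, whence v = v^* and v is in P ([polar_reflection]).
    Conversely s v with v in P and s strictly positive satisfies
    (s v)^* a (s v) = a exactly when s a s = v a v.  This equation has a
    unique strictly positive solution, the geometric mean
    s = b^-1 ((b v b)^2)^(1/2) b^-1 of a^-1 and v a v; as v s^-1 v is another
    solution, s = v s^-1 v, that is, (s v)^2 = 1.  So v |-> s v inverts pi on P_a
    ([polarInverseK], [polarUnitaryK]).

    Continuity.  The square root is locally Lipschitz on the cone
    ([sqrt_lipschitz]), products and the involution are continuous, and on P_a one
    has pi(e) = e (e e^* )^(1/2), so that no inverse occurs. *)

(** * The real-valued norm, the involution and the real scalars *)

Section Norm.
Local Open Scope complex_scope.
Context {R : realType} {A : cstarAlgType R}.
Implicit Types (x y z : A) (t s r : R).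

(** The norm of the algebra takes its values among the complex numbers; its real
    part carries the same information and lives in an ordered field. *)
Definition nm x : R := complex.Re (cnorm x).

Lemma cnormE x : cnorm x = (nm x)%:C.
Proof.
have h : 0 <= cnorm x by exact: (normr_ge0 (x : normed_space A)).
by rewrite /nm RRe_real // ger0_real.
Qed.

Lemma nm_ge0 x : 0 <= nm x.
Proof. by rewrite -ler0c -cnormE; exact: (normr_ge0 (x : normed_space A)). Qed.

Lemma nmD x y : nm (x + y) <= nm x + nm y.
Proof. by rewrite -lecR rmorphD /= -!cnormE cnormD. Qed.

Lemma nmM x y : nm (x * y) <= nm x * nm y.
Proof. by rewrite -lecR rmorphM /= -!cnormE cnormM. Qed.

Lemma nm0_eq0 x : nm x = 0 -> x = 0.
Proof. by move=> h; apply: cnorm0_eq0; rewrite cnormE h. Qed.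

Lemma nmN x : nm (- x) = nm x.
Proof. by rewrite /nm -scaleN1r cnormZ normrN1 mul1r. Qed.

Lemma nm0 : nm (0 : A) = 0.
Proof. by rewrite /nm -(scale0r 0) cnormZ normr0 mul0r. Qed.

Lemma nmB x y : nm (x - y) <= nm x + nm y.
Proof. by rewrite -(nmN y) nmD. Qed.

Lemma nm_distC x y : nm (x - y) = nm (y - x).
Proof. by rewrite -nmN opprB. Qed.

Lemma nm_starM x : nm (star x * x) = nm x ^+ 2.
Proof. by apply: complexI; rewrite rmorphXn /= -!cnormE cnorm_star. Qed.

Lemma nm_star x : nm (star x) = nm x.
Proof.
have le y : nm y <= nm (star y).
  have [->|y0] := eqVneq (nm y) 0; first exact: nm_ge0.
  have ygt : 0 < nm y by rewrite lt_neqAle eq_sym y0 nm_ge0.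
  by rewrite -(ler_pM2r ygt) -expr2 -nm_starM nmM.
by apply/eqP; rewrite eq_le le andbT -{2}(starK x) le.
Qed.

Lemma star0 : star 0 = 0 :> A.
Proof. by apply: (addrI (star 0)); rewrite -starD !addr0. Qed.

Lemma starN x : star (- x) = - star x.
Proof. by apply: (addrI (star x)); rewrite -starD !subrr star0. Qed.

Lemma starB x y : star (x - y) = star x - star y.
Proof. by rewrite starD starN. Qed.

Lemma star1 : star 1 = 1 :> A.
Proof. by rewrite -[RHS]starK -[in RHS](mul1r (star 1)) starM starK mul1r. Qed.

Lemma star_sqr x : star (x ^+ 2) = star x ^+ 2.
Proof. by rewrite !expr2 starM. Qed.

Lemma unit_star x : x \is a GRing.unit -> star x \is a GRing.unit.
Proof.
move=> ux; apply/unitrP; exists (star x^-1).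
by rewrite -!starM mulrV // mulVr // star1.
Qed.

Lemma starV x : x \is a GRing.unit -> star x^-1 = (star x)^-1.
Proof.
move=> ux; apply: (mulrI (unit_star ux)).
by rewrite -starM mulVr // star1 mulrV // unit_star.
Qed.

Lemma nm1 : nm (1 : A) = 1.
Proof.
have n0 : nm (1 : A) != 0 by apply/eqP => /nm0_eq0/eqP; rewrite oner_eq0.
by apply: (mulfI n0); rewrite mulr1 -expr2 -nm_starM star1 mulr1.
Qed.

(** The copy of the reals inside the algebra: writing t 1 as an element keeps all
    computations inside the ring, where these elements are central. *)
Definition sc t : A := (t%:C)%:A.

Lemma sc0 : sc 0 = 0. Proof. by rewrite /sc scale0r. Qed.
Lemma sc1 : sc 1 = 1. Proof. by rewrite /sc scale1r. Qed.
Lemma scD t s : sc (t + s) = sc t + sc s.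
Proof. by rewrite /sc rmorphD scalerDl. Qed.
Lemma scN t : sc (- t) = - sc t.
Proof. by rewrite /sc rmorphN scaleNr. Qed.
Lemma scB t s : sc (t - s) = sc t - sc s.
Proof. by rewrite scD scN. Qed.
Lemma scM t s : sc (t * s) = sc t * sc s.
Proof. by rewrite /sc rmorphM -scalerA mulr_algl. Qed.
Lemma scC t x : GRing.comm (sc t) x.
Proof. by rewrite /GRing.comm /sc mulr_algl mulr_algr. Qed.
Lemma star_sc t : star (sc t) = sc t.
Proof. by rewrite /sc starZ star1 conj_Creal // complex_real. Qed.
Lemma nm_sc t x : nm (sc t * x) = `|t| * nm x.
Proof.
apply: complexI; rewrite rmorphM /= -!cnormE /sc mulr_algl cnormZ.
by rewrite normc_def /= expr0n addr0 sqrtr_sqr.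
Qed.
Lemma nm_sc1 t : nm (sc t) = `|t|.
Proof. by rewrite -[sc t]mulr1 nm_sc nm1 mulr1. Qed.
Lemma scVK t : t != 0 -> sc t^-1 * sc t = 1.
Proof. by move=> t0; rewrite -scM mulVf // sc1. Qed.
Lemma unit_sc t : t != 0 -> sc t \is a GRing.unit.
Proof.
by move=> t0; apply/unitrP; exists (sc t^-1); rewrite (scC t) scVK.
Qed.

End Norm.

(** * Fixed points of contractions *)

Section Fix.
Local Open Scope complex_scope.
Context {R : realType} {A : cstarAlgType R}.
Implicit Types (x y z : A) (t s r : R).

Lemma nm_cauchy_cvg (y : nat -> A) :
  (forall e : R, 0 < e ->
    exists N, forall n, (N <= n)%N -> nm (y N - y n) < e) ->
  exists p, forall e : R, 0 < e ->
    exists N, forall n, (N <= n)%N -> nm (p - y n) < e.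
Proof.
move=> h; pose u : nat -> normed_space A := y.
have Re_gt0 (e : R[i]) : 0 < e -> e = (complex.Re e)%:C /\ 0 < complex.Re e.
  by case: e => a b; rewrite ltcE /= => /andP[/eqP -> ->].
have cu : cvg (u @ \oo).
  apply: (@cauchy_cvg (normed_space A)); apply: cauchy_exP => e /Re_gt0[-> e0].
  have [N NP] := h _ e0; exists (u N), N => // n /= Nn.
  by rewrite -ball_normE /= -[X in X < _]/(cnorm (y N - y n)) cnormE ltcR NP.
exists (lim (u @ \oo) : A) => e e0.
have /cvgrPdist_lt /(_ e%:C) := cu.
rewrite ltcR => /(_ e0) [N _ NP]; exists N => n Nn.
by rewrite -ltcR -cnormE; exact: NP.
Qed.

(** Banach's theorem on a set U that need not be given as a closed set of the
    normed space: the closure condition is the one met below, that elements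
    approximated from U lie in U.  Putting a property into U transfers it from the
    starting point of the iteration to the fixed point. *)
Lemma nm_fixpoint (U : set A) (f : A -> A) (r : R) (b : A) :
  (forall x, (forall e : R, 0 < e -> exists2 u, U u & nm (x - u) < e) -> U x) ->
  U b -> 0 <= r < 1 ->
  (forall x, U x -> U (f x)) ->
  (forall x y, U x -> U y -> nm (f x - f y) <= r * nm (x - y)) ->
  exists2 p, U p & f p = p.
Proof.
move=> clU Ub /andP[r0 r1] fU flip.
pose y n := iter n f b.
have Uy n : U (y n) by elim: n => //= n IH; exact: fU.
(* C solves C = r C + nm (f b - b), so it bounds the distance to b of all
   iterates; by contraction the tail from N on has diameter at most C r^N. *)
pose C := nm (f b - b) / (1 - r).
have r1' : 0 < 1 - r by rewrite subr_gt0.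
have yb n : nm (b - y n) <= C.
  elim: n => [|n IH]; first by rewrite subrr nm0 divr_ge0 ?nm_ge0 // ltW.
  have -> : b - y n.+1 = (b - f b) + (f b - f (y n)) by rewrite addrA subrK.
  apply: le_trans (nmD _ _) _; rewrite nm_distC.
  have -> : nm (f b - b) = C * (1 - r) by rewrite divfK // gt_eqF.
  have := flip _ _ Ub (Uy n); move: IH; nra.
have yN N n : nm (y N - y (N + n)%N) <= C * r ^+ N.
  elim: N => [|N IH]; first by rewrite expr0 mulr1.
  rewrite addSn; apply: le_trans (flip _ _ (Uy _) (Uy _)) _.
  by rewrite exprS mulrCA ler_wpM2l.
have [e e0|p yp] := nm_cauchy_cvg (y := y).
  have : C * r ^+ n @[n --> \oo] --> C * 0.
    by apply: cvgMr; apply: cvg_expr; rewrite ger0_norm.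
  rewrite mulr0 => /cvgr_lt /(_ _ e0) [N _ NP].
  exists N => n Nn; rewrite -(subnKC Nn); apply: le_lt_trans (yN _ _) _.
  exact: (NP N (leqnn N)).
have Up : U p by apply: clU => e /yp [N NP]; exists (y N) => //; exact: NP.
exists p => //; apply/subr0_eq/nm0_eq0/eqP; rewrite eq_le nm_ge0 andbT.
apply/ler_addgt0Pr => e e0; rewrite add0r.
have e20 : 0 < e / 2 by lra.
have [N NP] := yp _ e20.
have -> : f p - p = (f p - y N.+1) + (y N.+1 - p) by rewrite addrA subrK.
apply: le_trans (nmD _ _) _; rewrite [nm (y _ - _)]nm_distC.
have := flip p (y N) Up (Uy N); have := NP N (leqnn _).
have := NP N.+1 (leqnSn _); have := nm_ge0 (p - y N).
rewrite /=; nra.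
Qed.
End Fix.

(** * Strictly positive elements and their square roots *)

Section Spos.
Local Open Scope complex_scope.
Context {R : realType} {A : cstarAlgType R}.
Implicit Types (x y z : A) (t s r : R).

(** An approximation estimate with a fixed constant c, which is how commutation
    and selfadjointness will be seen to pass to limits. *)
Lemma eq0_nm_small x (c : R) : 0 <= c ->
  (forall e : R, 0 < e -> nm x <= c * e) -> x = 0.
Proof.
move=> c0 h; apply/nm0_eq0/eqP; rewrite eq_le nm_ge0 andbT.
apply/ler_addgt0Pr => e e0; rewrite add0r.
have c1 : 0 < c + 1 by lra.
apply: le_trans (h (e / (c + 1)) _) _; first exact: divr_gt0.
by rewrite mulrA ler_pdivrMr //; nra.
Qed.

Lemma comm_lim z x :
  (forall e : R, 0 < e -> exists2 u, GRing.comm z u & nm (x - u) < e) ->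
  GRing.comm z x.
Proof.
move=> h; apply: subr0_eq; apply: (@eq0_nm_small _ (2 * nm z)).
  by rewrite mulr_ge0 ?nm_ge0.
move=> e /h [u zu ux].
have -> : z * x - x * z = z * (x - u) - (x - u) * z.
  by rewrite mulrBr mulrBl zu opprB addrA subrK.
apply: le_trans (nmB _ _) _.
have := nmM z (x - u); have := nmM (x - u) z; have := nm_ge0 z; nra.
Qed.

Lemma sa_lim x :
  (forall e : R, 0 < e -> exists2 u, star u = u & nm (x - u) < e) ->
  star x = x.
Proof.
move=> h; apply: subr0_eq; apply: (@eq0_nm_small _ 2) => // e /h [u su ux].
have -> : star x - x = star (x - u) - (x - u).
  by rewrite starB su opprB addrA subrK.
by apply: le_trans (nmB _ _) _; rewrite nm_star; lra.
Qed.

Lemma nm_le_lim x (c : R) :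
  (forall e : R, 0 < e -> exists2 u, nm u <= c & nm (x - u) < e) ->
  nm x <= c.
Proof.
move=> h; apply/ler_addgt0Pr => e /h [u uc ux].
by rewrite -(subrK u x); apply: le_trans (nmD _ _) _; lra.
Qed.

(** The Neumann series, obtained as the fixed point of p |-> 1 + h p within the
    commutant of h, so that it is a two-sided inverse. *)
Lemma unit_1B (h : A) : nm h < 1 -> 1 - h \is a GRing.unit.
Proof.
move=> h1.
have [|||||p hp pE] := @nm_fixpoint R A [set p | GRing.comm h p]
   (fun p => 1 + h * p) (nm h) 0.
- by move=> x /= /comm_lim.
- exact: commr0.
- by rewrite nm_ge0.
- by move=> x /= hx; apply: commrD; [exact: commr1|exact: commrM].
- move=> x y _ _.
  have -> : 1 + h * x - (1 + h * y) = h * (x - y).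
    by rewrite mulrBr opprD addrACA subrr add0r.
  exact: nmM.
apply/unitrP; exists p; split.
  by rewrite mulrBr mulr1 -hp -{1}pE addrK.
by rewrite mulrBl mul1r -{1}pE addrK.
Qed.

(** Strict positivity in terms of the norm: the spectrum of a selfadjoint x lies
    in a disc around t of radius less than t.  It will turn out to be the same as
    being positive and invertible. *)
Definition spos x := star x = x /\ exists t, nm (sc t - x) < t.

Lemma ball_radius_gt0 x t : nm (sc t - x) < t -> 0 < t.
Proof. exact: le_lt_trans (nm_ge0 _). Qed.

Lemma spos_unit x : spos x -> x \is a GRing.unit.
Proof.
move=> [_ [t xt]]; have t0 := ball_radius_gt0 xt.
have tn : t != 0 by rewrite gt_eqF.
have -> : x = sc t * (1 - sc t^-1 * (sc t - x)).
  by rewrite mulrBr mulr1 mulrA -scM mulfV // sc1 mul1r subKr.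
rewrite unitrMl ?unit_sc //; apply: unit_1B.
by rewrite nm_sc ger0_norm ?invr_ge0 1?ltW // mulrC ltr_pdivrMr // mul1r.
Qed.

Lemma sposD x y : spos x -> spos y -> spos (x + y).
Proof.
move=> [sx [t xt]] [sy [s ys]]; split; first by rewrite starD sx sy.
exists (t + s); rewrite scD opprD addrACA.
by apply: le_lt_trans (nmD _ _) _; apply: ltrD.
Qed.

Lemma spos_sc t : 0 < t -> spos (sc t : A).
Proof.
by move=> t0; split; [rewrite star_sc|exists t; rewrite subrr nm0].
Qed.

Lemma sposM_sc t x : 0 < t -> spos x -> spos (sc t * x).
Proof.
move=> t0 [sx [s xs]]; split; first by rewrite starM star_sc sx scC.
exists (t * s); rewrite scM -mulrBr nm_sc ger0_norm ?ltW //.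
by rewrite ltr_pM2l.
Qed.

Lemma spos_Bsc x (M : R) : star x = x -> nm x < M -> spos (sc M - x).
Proof.
move=> sx xM; split; first by rewrite starB star_sc sx.
by exists M; rewrite subKr.
Qed.

(** y lies in the bicommutant of x. *)
Definition bicomm x y := forall z, GRing.comm z x -> GRing.comm z y.

(** Looking for the root in the form s = t - k, the equation s^2 = x becomes
    k = (t^2 - x + k^2) / 2t, whose right-hand side contracts the ball of radius
    r t by the factor r.  The explicit bound on t - s is what makes the square root
    locally Lipschitz. *)
Lemma sqrt_ball x t r : star x = x -> 0 < t -> 0 <= r < 1 ->
  nm (sc (t ^+ 2) - x) <= r * t ^+ 2 ->
  exists s : A,
    [/\ star s = s, s ^+ 2 = x, bicomm x s & nm (sc t - s) <= r * t].
Proof.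
move=> sx t0 /andP[r0 r1] xt.
have tt0 : 0 < (t + t)^-1 by rewrite invr_gt0 addr_gt0.
have ttn : t + t != 0 by rewrite gt_eqF // addr_gt0.
pose U := [set k : A | [/\ star k = k, bicomm x k & nm k <= r * t]].
have [|||||k [sk xk kt] kE] := @nm_fixpoint R A U
   (fun k => sc (t + t)^-1 * (sc (t ^+ 2) - x + k ^+ 2)) r 0.
- move=> k hk; split.
  + by apply: sa_lim => e /hk [u [? _ _] ?]; exists u.
  + by move=> z zx; apply: comm_lim => e /hk [u [_ h _] ?]; exists u => //;
    exact: h.
  + by apply: nm_le_lim => e /hk [u [_ _ ?] ?]; exists u.
- split; [by rewrite star0|by move=> z _; exact: commr0|].
  by rewrite nm0 mulr_ge0 // ltW.
- by rewrite r0.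
- move=> k [sk xk kt]; split.
  + by rewrite starM star_sc starD starB star_sc star_sqr sx sk scC.
  + move=> z zx; apply: commrM; first exact/commr_sym/scC.
    apply: commrD; last exact/commrX/xk.
    by apply: commrB => //; exact/commr_sym/scC.
  + rewrite nm_sc gtr0_norm // mulrC ler_pdivrMr ?addr_gt0 //.
    apply: le_trans (nmD _ _) _; rewrite (expr2 k).
    have k2 : nm k * nm k <= r * t * (r * t) by rewrite ler_pM ?nm_ge0.
    have rt : r * t * (r * t) <= r * t ^+ 2.
      rewrite mulrACA -expr2 -expr2 ler_wpM2r ?sqr_ge0 //.
      by rewrite expr2 ler_piMl // ltW.
    have := nmM k k; nra.
- move=> k l [_ _ kt] [_ _ lt].
  rewrite -mulrBr nm_sc gtr0_norm // mulrC ler_pdivrMr ?addr_gt0 //.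
  have -> : sc (t ^+ 2) - x + k ^+ 2 - (sc (t ^+ 2) - x + l ^+ 2)
    = k * (k - l) + (k - l) * l.
    by rewrite opprD addrACA subrr add0r mulrBr mulrBl addrA subrK !expr2.
  apply: le_trans (nmD _ _) _.
  have := nmM k (k - l); have := nmM (k - l) l.
  have : nm k * nm (k - l) <= r * t * nm (k - l) by rewrite ler_wpM2r ?nm_ge0.
  have : nm (k - l) * nm l <= nm (k - l) * (r * t) by rewrite ler_wpM2l ?nm_ge0.
  nra.
exists (sc t - k); split.
- by rewrite starB star_sc sk.
- have {}kE : sc (t ^+ 2) - x + k ^+ 2 = sc t * k + sc t * k.
    by rewrite -mulrDl -scD -[in RHS]kE mulrA -scM mulfV // sc1 mul1r.
  have k2 : k ^+ 2 = sc t * k + sc t * k - (sc (t ^+ 2) - x).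
    by rewrite -kE addrAC subrr add0r.
  rewrite expr2 mulrBl !mulrBr -scM -expr2 -expr2 -(scC t k) opprB.
  by rewrite addrACA -opprD k2 -addrA [_ - _ - _]addrAC subrr add0r subKr.
- by move=> z zx; apply: commrB; [exact/commr_sym/scC|exact: xk].
- by rewrite subKr.
Qed.

Lemma spos_sqrt x : spos x -> exists y, [/\ spos y, y ^+ 2 = x & bicomm x y].
Proof.
move=> [sx [t xt]]; have t0 := ball_radius_gt0 xt.
have tE : Num.sqrt t ^+ 2 = t by rewrite sqr_sqrtr // ltW.
have u0 : 0 < Num.sqrt t by rewrite sqrtr_gt0.
have [||s [ss sE xs ts]] := @sqrt_ball x (Num.sqrt t) (nm (sc t - x) / t) sx u0.
- by rewrite divr_ge0 ?nm_ge0 ?ltW //= ltr_pdivrMr // mul1r.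
- by rewrite tE divfK // gt_eqF.
exists s; split => //; split => //; exists (Num.sqrt t).
apply: le_lt_trans ts _.
by rewrite mulrC gtr_pMr // ltr_pdivrMr // mul1r.
Qed.

End Spos.

(** * Squares of selfadjoint elements *)

Section Squares.
Local Open Scope complex_scope.
Context {R : realType} {A : cstarAlgType R}.
Implicit Types (x y z a b : A) (t s r M d : R).

Lemma nm_sqr_sa x : star x = x -> nm (x ^+ 2) = nm x ^+ 2.
Proof. by move=> sx; rewrite -nm_starM sx expr2. Qed.

Lemma saM x y : star x = x -> star y = y -> GRing.comm x y ->
  star (x * y) = x * y.
Proof. by move=> sx sy xy; rewrite starM sx sy xy. Qed.

Lemma saV x : star x = x -> x \is a GRing.unit -> star x^-1 = x^-1.
Proof. by move=> sx ux; rewrite starV // sx. Qed.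

Lemma star_addi a b : star a = a -> star b = b ->
  star (a + 'i%R *: b) = a - 'i%R *: b.
Proof. by move=> sa sb; rewrite starD starZ sa sb conjCi scaleNr. Qed.

Lemma mul_addi a b : GRing.comm a b ->
  (a - 'i%R *: b) * (a + 'i%R *: b) = a ^+ 2 + b ^+ 2.
Proof.
move=> ab; rewrite mulrBl !mulrDr -!scalerAl -!scalerAr scalerA.
by rewrite -(expr2 'i) sqrCi scaleN1r -ab opprD opprK addrA addrK !expr2.
Qed.

(** c = a + ib is normal with c^* c = a^2 + b^2, and 2 a = c + c^* gives
    ||a|| <= ||c||.  This replaces the order-theoretic monotonicity of the norm. *)
Lemma nm_sqr_le_sumsq a b : star a = a -> star b = b -> GRing.comm a b ->
  nm (a ^+ 2) <= nm (a ^+ 2 + b ^+ 2).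
Proof.
move=> sa sb ab; rewrite -mul_addi // -star_addi // nm_starM nm_sqr_sa //.
rewrite ler_sqr ?nnegrE ?nm_ge0 //.
have : nm (sc 2 * a) <= nm (a + 'i%R *: b) + nm (star (a + 'i%R *: b)).
  apply: le_trans (nmD _ _).
  by rewrite star_addi // addrACA subrr addr0 scD sc1 mulrDl mul1r.
rewrite nm_star nm_sc ger0_norm //; lra.
Qed.

(** With c the square root of M^2 - y^2, the left-hand side is ||c^2||, which is at
    most ||c^2 + y^2|| = M^2. *)
Lemma nm_Bsqr y M : star y = y -> nm y < M ->
  nm (sc (M ^+ 2) - y ^+ 2) <= M ^+ 2.
Proof.
move=> sy yM; have M0 : 0 < M by apply: le_lt_trans yM; exact: nm_ge0.
have [|c [[sc_ _] cE cy]] := @spos_sqrt R A (sc (M ^+ 2) - y ^+ 2).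
  apply: spos_Bsc; first by rewrite star_sqr sy.
  by rewrite nm_sqr_sa // ltr_sqr ?nnegrE ?nm_ge0 // ltW.
have yc : GRing.comm c y.
  apply/commr_sym/cy/commrB; [exact/commr_sym/scC|exact/commrX].
rewrite -cE; apply: le_trans (nm_sqr_le_sumsq sc_ sy yc) _.
by rewrite cE subrK nm_sc1 ger0_norm // sqr_ge0.
Qed.

Lemma spos_sqrD y d : star y = y -> 0 < d -> spos (y ^+ 2 + sc d).
Proof.
move=> sy d0; split; first by rewrite starD star_sc star_sqr sy.
exists ((nm y + 1) ^+ 2 + d).
rewrite scD opprD addrACA subrr addr0.
by apply: le_lt_trans (nm_Bsqr sy _) _; lra.
Qed.

(** If z = a + ib and y = x - a, then (y - ib)(y + ib) = y^2 + b^2 is strictly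
    positive, hence invertible, and the factors commute. *)
Lemma unit_sub_nonreal x (z : R[i]) : star x = x -> complex.Im z != 0 ->
  x - z%:A \is a GRing.unit.
Proof.
case: z => a b /= sx b0.
pose y := x - sc a.
have sy : star y = y by rewrite starB star_sc sx.
have -> : (Complex a b)%:A = sc a + 'i%R *: sc b :> A.
  by rewrite [Complex a b]complexE /= scalerDl /sc scalerA.
rewrite opprD addrA -/y.
have cyb : GRing.comm y (sc b) by exact/commr_sym/scC.
have cyi : GRing.comm y ('i%R *: sc b).
  by rewrite /GRing.comm -scalerAl -scalerAr cyb.
have : y ^+ 2 + sc b ^+ 2 \is a GRing.unit.
  apply: spos_unit; rewrite (expr2 (sc b)) -scM; apply: spos_sqrD => //.
  by rewrite -expr2 exprn_even_gt0.
rewrite -mul_addi // unitrM_comm; first by case/andP.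
by apply: commrD; apply/commr_sym/commrB => //; exact/commr_sym.
Qed.

(** [spos_sqrD] gives y^2 + d for every d > 0; to gain the missing margin at d = 0,
    write M - y^-2 = c^2 for a large M and observe M y^2 = (y c)^2 + 1. *)
Lemma spos_sqr_unit y : star y = y -> y \is a GRing.unit -> spos (y ^+ 2).
Proof.
move=> sy uy; pose M := nm (y ^- 2) + 1.
have M0 : 0 < M by rewrite /M; have := nm_ge0 (y ^- 2); lra.
have sV : star (y ^- 2) = y ^- 2 by rewrite -exprVn star_sqr saV.
have [|c [[scc _] cE cM]] := @spos_sqrt R A (sc M - y ^- 2).
  by apply: spos_Bsc => //; rewrite ltrDl.
have yc : GRing.comm y c.
  by apply: cM; apply: commrB; [exact/commr_sym/scC|exact/commrV/commrX].
have -> : y ^+ 2 = sc M^-1 * ((y * c) ^+ 2 + sc 1).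
  rewrite exprMn_comm // cE mulrBr mulrV ?unitrX // sc1 subrK -(scC M).
  by rewrite mulrA scVK ?mul1r // gt_eqF.
apply: sposM_sc; first by rewrite invr_gt0.
by apply: spos_sqrD => //; exact: saM.
Qed.

Lemma spos_sqr x : spos x -> spos (x ^+ 2).
Proof. by move=> px; apply: spos_sqr_unit; [case: px|exact: spos_unit]. Qed.

(** The root c of x^2 given by [spos_sqrt] commutes with any other root z, since z
    commutes with z^2; then (z + c) (z - c) = 0 and z + c is invertible. *)
Lemma spos_sqrt_uniq x y : spos x -> spos y -> x ^+ 2 = y ^+ 2 -> x = y.
Proof.
move=> px py xy.
have [c [pc cE cx]] := spos_sqrt (spos_sqr px).
have h z : spos z -> z ^+ 2 = x ^+ 2 -> z = c.
  move=> pz zx; have zc : GRing.comm z c.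
    by apply: cx; rewrite -zx; exact/commrX.
  have /mulrI : z + c \is a GRing.unit by apply/spos_unit/sposD.
  by apply; rewrite !mulrDl -zc -!expr2 zx cE addrC.
by rewrite (h x) // (h y).
Qed.

Lemma sposM x y : GRing.comm x y -> spos x -> spos y -> spos (x * y).
Proof.
move=> xy px py.
have [c [pc cE cx]] := spos_sqrt px; have [d [pd dE dy]] := spos_sqrt py.
have cd : GRing.comm c d by apply/dy/commr_sym/cx/commr_sym.
rewrite -cE -dE -exprMn_comm //; apply: spos_sqr_unit.
  by apply: saM => //; [case: pc|case: pd].
by rewrite unitrMl spos_unit.
Qed.

Lemma sposV x : spos x -> spos x^-1.
Proof.
move=> /spos_sqrt [c [pc <- _]]; rewrite -exprVn; apply: spos_sqr_unit.
  by apply: saV; [case: pc|exact: spos_unit].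
by rewrite unitrV spos_unit.
Qed.
End Squares.

(** * Strict positivity and the spectrum *)

Section Spectrum.
Local Open Scope complex_scope.
Context {R : realType} {A : cstarAlgType R}.
Implicit Types (x y z g p : A) (t M d : R).

Lemma sposDsc x t : 0 <= t -> spos x -> spos (x + sc t).
Proof.
rewrite le_eqVlt => /orP[/eqP <-|t0 px]; first by rewrite sc0 addr0.
by apply: sposD => //; exact: spos_sc.
Qed.

Lemma positive_unitD x : star x = x ->
  (forall t, 0 < t -> x + sc t \is a GRing.unit) -> positive x.
Proof.
move=> sx ux; split=> // z /= /negP nz; rewrite lecE /=.
have [Iz|Iz] := eqVneq (complex.Im z) 0; last first.
  by exfalso; apply: nz; exact: unit_sub_nonreal.
rewrite andTb leNgt; apply/negP => Rz; apply: nz.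
have -> : z%:A = sc (complex.Re z) :> A.
  by rewrite {1}[z]complexE Iz mulr0 addr0.
by rewrite -scN; apply: ux; rewrite oppr_gt0.
Qed.

Lemma spos_posInvertible x : spos x -> posInvertible A x.
Proof.
move=> px; have [sx _] := px; split; first exact: spos_unit.
by apply: positive_unitD => // t t0; apply/spos_unit/sposDsc => //; exact: ltW.
Qed.

(** The cone is closed among invertible elements, in quantitative form.  With
    e = 1/M and w = (y + e)^-1 the choice of M makes ||w|| < M, so M - w is strictly
    positive, and (M - w) (y + e) = M y. *)
Lemma spos_step y M : star y = y -> y \is a GRing.unit ->
  M = 2 * nm y^-1 + 1 -> spos (y + sc M^-1) -> spos y.
Proof.
move=> sy uy ME py.
have V0 := nm_ge0 y^-1.
have M0 : 0 < M by rewrite ME; lra.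
have MM : M^-1 * M = 1 by rewrite mulVf // gt_eqF.
have e0 : 0 < M^-1 by rewrite invr_gt0.
pose w := (y + sc M^-1)^-1.
have uw := spos_unit py.
have [sw _] : spos w := sposV py.
have wE : w = y^-1 - sc M^-1 * (y^-1 * w).
  apply: (mulrI uy); rewrite mulrBr mulrV // mulrA -(scC _ y) -!mulrA.
  rewrite (mulVKr uy); apply/eqP; rewrite eq_sym subr_eq -mulrDl.
  by rewrite /w mulrV.
have w2 : nm w < M.
  have : nm w <= nm y^-1 + M^-1 * (nm y^-1 * nm w).
    rewrite {1}wE; apply: le_trans (nmB _ _) _; rewrite lerD2l.
    by rewrite nm_sc gtr0_norm // ler_pM2l // nmM.
  have : M^-1 * (nm y^-1 * nm w) <= 2^-1 * nm w.
    rewrite mulrA ler_wpM2r ?nm_ge0 //.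
    by nra.
  lra.
have -> : y = sc M^-1 * ((sc M - w) * (y + sc M^-1)).
  rewrite mulrBl mulVr // (mulrDr (sc M)) -(scM M) mulfV ?gt_eqF // sc1 addrK.
  by rewrite mulrA scVK ?mul1r // gt_eqF.
apply: sposM_sc => //; apply: sposM => //; last exact: spos_Bsc.
by apply/commr_sym/commrB; [exact/commr_sym/scC|exact/commrV].
Qed.

Lemma spos_open y : spos y -> exists2 d, 0 < d & spos (y - sc d).
Proof.
move=> [sy [t yt]]; exists ((t - nm (sc t - y)) / 2); first by lra.
split; first by rewrite starB star_sc sy.
exists (t - (t - nm (sc t - y)) / 2).
by rewrite [X in X - _]scB opprB addrA subrK; lra.
Qed.

(** The set S of l >= 0 with x + l strictly positive contains all large l.
    Every x + l with l >= 0 is invertible, so [spos_step] puts the infimum of S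
    into S, and [spos_open] would allow to go below a nonzero infimum. *)
Lemma posInvertible_spos x : posInvertible A x -> spos x.
Proof.
move=> [ux [sx spx]].
have ul l : 0 <= l -> x + sc l \is a GRing.unit.
  rewrite le_eqVlt => /orP[/eqP <-|l0]; first by rewrite sc0 addr0.
  apply: contrapT => /negP nu; have := spx ((- l)%:C).
  by rewrite /spectrum /= -/(sc (- l)) scN opprK => /(_ nu); rewrite ler0c; lra.
pose S := [set l : R | 0 <= l /\ spos (x + sc l)].
have S0 : S !=set0.
  exists (nm x + 1); split; first by have := nm_ge0 x; lra.
  have -> : x + sc (nm x + 1) = sc (nm x + 1) - (- x) by rewrite opprK addrC.
  by apply: spos_Bsc; rewrite ?starN ?sx // nmN; lra.
have lbS : lbound S 0 by move=> l [].
have hS : has_inf S by split=> //; exists 0.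
have l0 : 0 <= inf S by exact: lb_le_inf.
pose y := x + sc (inf S).
have py : spos y.
  have sy : star y = y by rewrite starD star_sc sx.
  apply: (spos_step sy (ul _ l0) erefl).
  set e := _^-1; have e0 : 0 < e.
    by rewrite invr_gt0; have := nm_ge0 y^-1; lra.
  have [l [_ pl] le] := inf_adherent e0 hS.
  have -> : y + sc e = x + sc l + sc (inf S + e - l).
    by rewrite /y -!addrA -!scD; congr (_ + sc _); lra.
  by apply: sposDsc => //; rewrite subr_ge0 ltW.
have [d d0 pd] := spos_open py.
have [il0|il0] := leP (inf S) 0.
  by move: py; rewrite /y (_ : inf S = 0) ?sc0 ?addr0 //; lra.
have Sm : S (inf S - Num.min d (inf S)).
  split; first by rewrite subr_ge0 ge_min lexx orbT.
  have -> : x + sc (inf S - Num.min d (inf S))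
      = y - sc d + sc (d - Num.min d (inf S)).
    by rewrite /y -!addrA -scN -!scD; congr (_ + sc _); lra.
  by apply: sposDsc => //; rewrite subr_ge0 ge_min lexx.
have := ge_inf hS.2 Sm.
have : 0 < Num.min d (inf S) by rewrite lt_min d0.
lra.
Qed.

(** For t > 0, g p g + t = g (p + t g^-2) g is invertible because p + t g^-2 is
    strictly positive; so the spectrum of g p g is nonnegative. *)
Lemma spos_conj g p : star g = g -> g \is a GRing.unit -> spos p ->
  spos (g * p * g).
Proof.
move=> sg ug pp; apply: posInvertible_spos.
have [sp _] := pp.
have sgpg : star (g * p * g) = g * p * g by rewrite !starM sg sp mulrA.
split; first by rewrite unitrMl // unitrMl ?(spos_unit pp).
apply: positive_unitD => // t t0.
have -> : g * p * g + sc t = g * (p + sc t * g^-1 ^+ 2) * g.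
  rewrite mulrDr mulrDl mulrA -(scC t g) -!mulrA.
  by rewrite mulVr // mulr1 mulrV // mulr1.
rewrite !unitrMl //; apply/spos_unit/sposD => //; apply: sposM_sc => //.
by apply: spos_sqr_unit; [exact: saV|rewrite unitrV].
Qed.
End Spectrum.

(** * Polar decomposition of reflections and its inverse *)

Section Polar.
Local Open Scope complex_scope.
Context {R : realType} {A : cstarAlgType R}.
Implicit Types (x y z a b e u v p q s : A) (t r M d : R).

Lemma spos_sa x : spos x -> star x = x. Proof. by case. Qed.

Lemma spos_unitary_conj u p : star u * u = 1 -> u * star u = 1 -> spos p ->
  spos (star u * p * u).
Proof.
move=> uu uu' [sp [t pt]]; split; first by rewrite !starM starK sp mulrA.
exists t; have -> : sc t - star u * p * u = star u * (sc t - p) * u.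
  by rewrite mulrBr mulrBl -scC -[sc t * _ * u]mulrA uu mulr1.
have nu : nm u = 1.
  by apply/eqP; rewrite -(@eqrXn2 _ 2) ?nm_ge0 // -nm_starM uu nm1 expr1n.
apply: le_lt_trans pt; apply: le_trans (nmM _ _) _; rewrite nu mulr1.
by apply: le_trans (nmM _ _) _; rewrite nm_star nu mul1r.
Qed.

(** The chosen root is meaningful on strictly positive elements: a positive root
    exists, and each one is invertible because its square is. *)
Lemma cstar_sqrt_spos x : spos x ->
  spos (cstar_sqrt x) /\ cstar_sqrt x ^+ 2 = x.
Proof.
move=> px; rewrite /cstar_sqrt; case: xgetP => [y _ [py yx]|h].
  split=> //; apply: posInvertible_spos; split=> //.
  by rewrite -(@unitrX_pos _ _ 2) // yx spos_unit.
have [y [py yx _]] := spos_sqrt px.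
by have [_ ?] := spos_posInvertible py; case: (h y).
Qed.

Lemma cstar_sqrt_sqr y : spos y -> cstar_sqrt (y ^+ 2) = y.
Proof.
move=> py; have [? ?] := cstar_sqrt_spos (spos_sqr py).
exact: spos_sqrt_uniq.
Qed.

Lemma orthReflectionP u : orthReflections A u <-> star u = u /\ u * u = 1.
Proof.
split=> [[[uu]]|[su uu]].
  rewrite expr2 => u2 [_ su]; split=> //.
  by rewrite su -[LHS]mulr1 -u2 mulKr.
have ? : u \is a GRing.unit by apply/unitrP; exists u.
by split; split=> //; rewrite su; apply: (mulrI (x := u)) => //; rewrite mulrV.
Qed.

Lemma polarUnitary_mul s u : spos s -> orthReflections A u ->
  polarUnitary (s * u) = u.
Proof.
move=> ps /orthReflectionP[su uu].
rewrite /polarUnitary starM su (spos_sa ps) -mulrA (mulrA u) uu mul1r -expr2.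
by rewrite cstar_sqrt_sqr // mulKr // spos_unit.
Qed.

(** The polar decomposition e = s v of a reflection: e = e^-1 reads
    e = (v^* s^-1 v) v^*, and uniqueness of the root of e e^* forces s = v^* s^-1 v,
    hence v^* = v.  *)
Lemma polar_reflection e : e * e = 1 -> spos (e * star e) ->
  let s := cstar_sqrt (e * star e) in
  [/\ spos s, orthReflections A (polarUnitary e), e = s * polarUnitary e
    & polarUnitary e = e * s].
Proof.
move=> ee pe s; have [ps s2] := cstar_sqrt_spos pe.
rewrite -/s in ps s2; have us := spos_unit ps; have ss := spos_sa ps.
set v := polarUnitary e.
have eE : e = s * v by rewrite mulVKr.
have sv : star v = star e * s^-1 by rewrite starM starV // ss.
have vv' : v * star v = 1.
  by rewrite sv /v /polarUnitary -/s -mulrA (mulrA e) -s2 expr2 mulrK // mulVr.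
have vv : star v * v = 1.
  have uv : v \is a GRing.unit.
    by rewrite unitrMl ?unitrV //; apply/unitrP; exists e.
  by rewrite -(mulKr uv (star v)) vv' mulr1 mulVr.
clearbody v.
have vE : e = star v * s^-1.
  have : e * (s * v) = 1 by rewrite -eE.
  by move/(congr1 (fun x => x * star v * s^-1)) => /=;
    rewrite mul1r !mulrA -(mulrA (e * s) v) vv' mulr1 mulrK.
have pE : star v * s^-1 * v = s.
  apply: spos_sqrt_uniq => //.
    by apply: spos_unitary_conj => //; exact: sposV.
  have ve : v * e = s^-1 by rewrite vE mulrA vv' mul1r.
  have se : star e = s^-1 * v by rewrite {1}vE starM starK starV // ss.
  by rewrite s2 -vE expr2 -mulrA (mulrA v) ve se.
have vsa : star v = v.
  by apply: (mulrI us); rewrite -eE -{1}pE -(mulrA _ v) vv' mulr1 -vE.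
split=> //; first by apply/orthReflectionP; split=> //; rewrite -{1}vsa.
by rewrite {1}vE vsa mulrVK.
Qed.

(** With b^2 = a, the squares of b s b and b s' b agree. *)
Lemma geometric_uniq a s s' : spos a -> spos s -> spos s' ->
  s * a * s = s' * a * s' -> s = s'.
Proof.
move=> pa ps ps'; have [b [pb <- _]] := spos_sqrt pa => h.
have ub := spos_unit pb; have sb := spos_sa pb.
apply: (mulrI ub); apply: (mulIr ub).
apply: spos_sqrt_uniq; [exact: spos_conj|exact: spos_conj|].
have E z : (b * z * b) ^+ 2 = b * (z * b ^+ 2 * z) * b.
  by rewrite !expr2 !mulrA.
by rewrite !E h.
Qed.

Lemma orthReflectionsOfP a e : spos a ->
  orthReflectionsOf a e <-> e * e = 1 /\ star e * a = a * e.
Proof.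
move=> pa; have ua := spos_unit pa.
have shE : e = sharp a e <-> star e * a = a * e.
  rewrite /sharp -mulrA; split=> [{2}->|->]; first by rewrite mulVKr.
  by rewrite mulKr.
split=> [[[_ e2] /shE ? _]|[ee /shE h]]; first by rewrite -expr2.
have ue : e \is a GRing.unit by apply/unitrP; exists e.
split=> //; rewrite -h.
by apply: (mulrI ue); rewrite ee mulrV.
Qed.

(** With b^2 = a, the element f = b e b^-1 is selfadjoint, because e is selfadjoint
    for the form defined by a, and e e^* = b^-1 (f a f) b^-1. *)
Lemma orthReflectionsOf_spos a e : spos a -> orthReflectionsOf a e ->
  spos (e * star e).
Proof.
move=> pa /(orthReflectionsOfP e pa)[ee ea].
have [b [pb bE _]] := spos_sqrt pa; rewrite expr2 in bE.
have ub := spos_unit pb; have sb := spos_sa pb.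
have ubV : b^-1 \is a GRing.unit by rewrite unitrV.
have sbV := saV sb ub.
pose f := b * e * b^-1.
have se : star e = b * b * e * b^-1 * b^-1.
  by rewrite bE -ea -bE mulrA !mulrK.
have sf : star f = f.
  by rewrite !starM sb sbV se /f -!mulrA mulKr // mulVr // mulr1.
have uf : f \is a GRing.unit.
  by rewrite !unitrMl //; apply/unitrP; exists e.
have -> : e * star e = b^-1 * (f * a * f) * b^-1.
  by rewrite se /f -bE !mulrA mulVr // mul1r mulrVK.
by apply: spos_conj => //; exact: spos_conj.
Qed.

(** The factor in front of u is the geometric mean of a^-1 and u a u. *)
Definition polarInverse a u : A :=
  (cstar_sqrt a)^-1 * cstar_sqrt ((cstar_sqrt a * u * cstar_sqrt a) ^+ 2)
    * (cstar_sqrt a)^-1 * u.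

Lemma geometric_solution a u : spos a -> orthReflections A u ->
  exists s, [/\ spos s, s * a * s = u * a * u & polarInverse a u = s * u].
Proof.
move=> pa /orthReflectionP[su uu]; rewrite /polarInverse.
have [pb] := cstar_sqrt_spos pa; set b := cstar_sqrt a in pb *.
rewrite expr2 => bE.
have ub := spos_unit pb; have sb := spos_sa pb.
have ubV : b^-1 \is a GRing.unit by rewrite unitrV.
have sbV := saV sb ub.
have uu' : u \is a GRing.unit by apply/unitrP; exists u.
have /cstar_sqrt_spos[pr r2] : spos ((b * u * b) ^+ 2).
  apply: spos_sqr_unit; first by rewrite !starM sb su mulrA.
  by rewrite !unitrMl.
set r := cstar_sqrt (_ ^+ 2) in pr r2 *.
exists (b^-1 * r * b^-1); split=> //; first exact: spos_conj.
have -> : b^-1 * r * b^-1 * a * (b^-1 * r * b^-1) = b^-1 * r ^+ 2 * b^-1.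
  by rewrite -bE expr2 !mulrA mulrVK // mulrK.
by rewrite r2 expr2 -bE !mulrA mulVr // mul1r mulrK.
Qed.

(** Both s and u s^-1 u solve t a t = u a u, so they agree; this is (s u)^2 = 1. *)
Lemma polarInverse_orthReflectionsOf a u : spos a -> orthReflections A u ->
  orthReflectionsOf a (polarInverse a u).
Proof.
move=> pa Pu; have [s [ps sas ->]] := geometric_solution pa Pu.
have /orthReflectionP[su uu] := Pu; have us := spos_unit ps.
have usu : u * s^-1 * u = s.
  apply: (@geometric_uniq a) => //.
    by rewrite -{1}su; apply: spos_unitary_conj; rewrite ?su //; exact: sposV.
  have -> : u * s^-1 * u * a * (u * s^-1 * u)
      = u * s^-1 * (u * a * u) * s^-1 * u.
    by rewrite !mulrA.
  by rewrite -sas !mulrA mulrVK // mulrK // sas.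
apply/orthReflectionsOfP => //; split.
  by rewrite -{2}usu !mulrA -(mulrA s u u) uu mulr1 mulrV // mul1r.
rewrite starM su (spos_sa ps); apply: (mulIr us).
rewrite -!mulrA (mulrA s) sas !mulrA uu mul1r -!mulrA; congr (_ * _).
by rewrite -{1}usu !mulrA -(mulrA _ u u) uu mulr1 mulrVK.
Qed.

Lemma polarInverseK a u : spos a -> orthReflections A u ->
  polarUnitary (polarInverse a u) = u.
Proof.
move=> pa Pu; have [s [ps _ ->]] := geometric_solution pa Pu.
exact: polarUnitary_mul.
Qed.

(** If e = s v lies in P_a then e^* a e = a reads s a s = v a v, and
    the strictly positive solution of this equation is unique. *)
Lemma polarUnitaryK a e : spos a -> orthReflectionsOf a e ->
  polarInverse a (polarUnitary e) = e.
Proof.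
move=> pa Pe; have /(orthReflectionsOfP e pa)[ee ea] := Pe.
have [ps Pv eE vE] := polar_reflection ee (orthReflectionsOf_spos pa Pe).
set s := cstar_sqrt _ in ps eE vE.
set v := polarUnitary e in Pv eE vE *; clearbody v.
have [s' [ps' sas ->]] := geometric_solution pa Pv.
rewrite [RHS]eE; congr (_ * _); apply: (@geometric_uniq a) => //.
have /orthReflectionP[sv vv] := Pv.
have se : star e = v * s by rewrite eE starM sv (spos_sa ps).
have aE : a = v * (s * a * s) * v.
  by rewrite -{1}[a]mulr1 -ee mulrA -ea se -mulrA {1}eE !mulrA.
by rewrite sas {1}aE !mulrA vv mul1r -mulrA vv mulr1.
Qed.
End Polar.

(** * Continuity *)

Section Continuity.
Local Open Scope complex_scope.
Context {R : realType} {A : cstarAlgType R}.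

(** Near l, [sqrt_ball] applies with the same t = w^2 and r, and uniqueness shows
    that the root p it produces is the chosen one: ||w - p|| <= r w.  Writing q
    for the root of l and d = p - q, the identity x - l = p d + d q becomes
    2 w d = (x - l) + (w - p) d + d (w - q), whence
    2 w (1 - r) ||d|| <= ||x - l||. *)
Lemma sqrt_lipschitz (l : A) : spos l -> exists d L : R, [/\ 0 < d, 0 < L &
  forall x, star x = x -> nm (x - l) < d ->
    nm (cstar_sqrt x - cstar_sqrt l) <= L * nm (x - l)].
Proof.
move=> pl; have [sl [t lt]] := pl; have t0 := ball_radius_gt0 lt.
have tE : Num.sqrt t ^+ 2 = t by rewrite sqr_sqrtr // ltW.
set w := Num.sqrt t in tE; have w0 : 0 < w by rewrite sqrtr_gt0.
pose m := nm (sc t - l); pose r := (1 + m / t) / 2.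
have m0 : 0 <= m by exact: nm_ge0.
have mt : 0 <= m / t < 1.
  by apply/andP; split; [rewrite divr_ge0 // ltW|rewrite ltr_pdivrMr // mul1r].
have r01 : 0 <= r < 1 by rewrite /r; lra.
have rt : r * t = (t + m) / 2 by rewrite /r; field; rewrite gt_eqF.
have near x : star x = x -> nm (sc t - x) <= r * t ->
    nm (sc w - cstar_sqrt x) <= r * w /\ cstar_sqrt x ^+ 2 = x.
  move=> sx; rewrite -tE => /(sqrt_ball sx w0 r01)[y [sy yE _ yw]].
  suff py : spos y by rewrite -yE cstar_sqrt_sqr.
  by split=> //; exists w; apply: le_lt_trans yw _; nra.
have [kl kl2] : nm (sc w - cstar_sqrt l) <= r * w /\ cstar_sqrt l ^+ 2 = l.
  by apply: near => //; rewrite rt -/m; lra.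
exists ((t - m) / 2), (2 * w * (1 - r))^-1; split; first lra.
  by rewrite invr_gt0 !mulr_gt0 //; lra.
move=> x sx xl.
have [kx kx2] : nm (sc w - cstar_sqrt x) <= r * w /\ cstar_sqrt x ^+ 2 = x.
  apply: near => //; rewrite rt.
  have -> : sc t - x = (sc t - l) - (x - l) by rewrite opprB addrA subrK.
  by apply: le_trans (nmB _ _) _; rewrite -/m; lra.
set p := cstar_sqrt x in kx kx2 *; set q := cstar_sqrt l in kl kl2 *.
rewrite mulrC ler_pdivlMr; last by rewrite !mulr_gt0 //; lra.
have E : x - l = p * (p - q) + (p - q) * q.
  by rewrite -kx2 -kl2 mulrBr mulrBl addrA subrK !expr2.
set d := p - q in E *; clearbody d.
have {}E : sc (2 * w) * d = (x - l) + ((sc w - p) * d + d * (sc w - q)).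
  rewrite E mulrBl mulrBr addrACA (addrC (p * d)) (addrC (d * q)) !subrK.
  by rewrite -(scC w d) -mulrDl -scD -mulr2n mulr_natl.
have : 2 * w * nm d <=
    nm (x - l) + (nm (sc w - p) * nm d + nm d * nm (sc w - q)).
  rewrite -[2 * w]gtr0_norm; last by rewrite mulr_gt0.
  rewrite -nm_sc E; apply: le_trans (nmD _ _) _; rewrite lerD2l.
  by apply: le_trans (nmD _ _) _; apply: lerD; exact: nmM.
have : nm (sc w - p) * nm d <= r * w * nm d by rewrite ler_wpM2r ?nm_ge0.
have : nm d * nm (sc w - q) <= nm d * (r * w) by rewrite ler_wpM2l ?nm_ge0.
lra.
Qed.

(** Convergence along F in terms of [nm]: the normed space carries no product, so
    the limits of products are stated for functions with values in the algebra. *)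
Definition tends (T : Type) (F : set_system T) (f : T -> A) (l : A) :=
  forall e : R, 0 < e -> \forall x \near F, nm (f x - l) < e.

Section Tends.
Context {T : Type} {F : set_system T} {FF : Filter F}.
Implicit Types (f g : T -> A).

Lemma tends_cst (l : A) : tends F (fun=> l) l.
Proof. by move=> e e0; apply: nearW => x; rewrite subrr nm0. Qed.

Lemma tends_star f (l : A) : tends F f l ->
  tends F (fun x => star (f x)) (star l).
Proof.
by move=> fl e /fl; apply: filterS => x; rewrite -starB nm_star.
Qed.

Lemma tends_mul f g (k l : A) : tends F f k -> tends F g l ->
  tends F (fun x => f x * g x) (k * l).
Proof.
move=> fk gl e e0; pose c := nm k + nm l + 1.
have c0 : 0 < c by rewrite /c; have := nm_ge0 k; have := nm_ge0 l; lra.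
have d0 : 0 < Num.min 1 (e / c) by rewrite lt_min ltr01 divr_gt0.
near=> x.
have : nm (f x - k) < Num.min 1 (e / c) by near: x; exact: fk.
have : nm (g x - l) < Num.min 1 (e / c) by near: x; exact: gl.
rewrite !lt_min => /andP[_ gx] /andP[fx1 fx].
have -> : f x * g x - k * l
    = (f x - k) * (g x - l) + ((f x - k) * l + k * (g x - l)).
  by rewrite addrA -mulrDr subrK mulrBl mulrBr addrA subrK.
have := nmM (f x - k) (g x - l); have := nmM (f x - k) l.
have := nmM k (g x - l).
have k0 := nm_ge0 k; have l0 := nm_ge0 l.
have := nm_ge0 (f x - k); have := nm_ge0 (g x - l).
have ec : e / c * c = e by rewrite divfK // gt_eqF.
set u := nm (f x - k) in fx fx1 *; set v := nm (g x - l) in gx *.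
move=> v0 u0 h1 h2 h3.
apply: le_lt_trans (nmD _ _) _.
apply: le_lt_trans (_ : _ <= v + (u * nm l + nm k * v)) _.
  have h4 := nmD ((f x - k) * l) (k * (g x - l)).
  apply: lerD; last by lra.
  by apply: le_trans h3 _; rewrite ler_piMl // ltW.
rewrite -ec {2}/c; nra.
Unshelve. all: by end_near. Qed.

Lemma tends_sqrt f (l : A) : spos l -> (\forall x \near F, star (f x) = f x) ->
  tends F f l -> tends F (fun x => cstar_sqrt (f x)) (cstar_sqrt l).
Proof.
move=> /sqrt_lipschitz[d [L [d0 L0 lip]]] sf fl e e0.
near=> x.
have sx : star (f x) = f x by near: x.
have xd : nm (f x - l) < d by near: x; exact: fl.
apply: le_lt_trans (lip _ sx xd) _.
rewrite mulrC -ltr_pdivlMr //; near: x.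
by apply: fl; rewrite divr_gt0.
Unshelve. all: by end_near. Qed.
End Tends.

Lemma tends_within_continuous (X : set A) (f : A -> A) :
  (forall x, X x -> tends (within X (nbhs (x : normed_space A))) f (f x)) ->
  {within (X : set (normed_space A)),
    continuous (f : normed_space A -> normed_space A)}.
Proof.
move=> h; apply/subspace_continuousP => x Xx; apply/cvgrPdist_lt.
case=> a b; rewrite ltcE /= => /andP[/eqP -> a0].
apply: filterS (h x Xx a a0) => y; rewrite -ltcR nm_distC -cnormE; exact.
Qed.

Lemma tends_id (X : set A) (x : A) :
  tends (within X (nbhs (x : normed_space A))) (fun y => y) x.
Proof.
move=> e e0; apply: cvg_within.
have : (e%:C : R[i]) > 0 by rewrite ltcR.
move=> /nbhsx_ballx - /(_ _ (x : normed_space A)).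
apply: filterS => y; rewrite -ball_normE /= nm_distC -ltcR -cnormE; exact.
Qed.
End Continuity.

(** * The homeomorphism *)

Theorem proposition3p3 (R : realType) (A : cstarAlgType R) (a : A)
    (ha : posInvertible A a) :
  [/\ polarUnitary @` orthReflectionsOf a
        = polarUnitary @` (reflections A `&` unitariesOf a),
      polarUnitary @` (reflections A `&` unitariesOf a) = orthReflections A &
      homeomorphism_on
        (orthReflectionsOf a : set (normed_space A))
        (orthReflections A : set (normed_space A))
        (polarUnitary : normed_space A -> normed_space A)].
Proof.
have pa := posInvertible_spos ha.
have Pa : reflections A `&` unitariesOf a = orthReflectionsOf a.
  apply/seteqP; split=> [e [[ue e2] [_ sh]]|e [[ue e2] _ sh]]; last by split.
  split=> //; rewrite sh; apply: (mulrI ue).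
  by rewrite mulrV // -expr2.
have polP e : orthReflectionsOf a e -> orthReflections A (polarUnitary e).
  move=> Pe; have [ee _] := (orthReflectionsOfP e pa).1 Pe.
  by have [] := polar_reflection ee (orthReflectionsOf_spos pa Pe).
have img : polarUnitary @` orthReflectionsOf a = orthReflections A.
  apply/seteqP; split=> [_ [e Pe <-]|u Pu]; first exact: polP.
  exists (polarInverse a u); first exact: polarInverse_orthReflectionsOf.
  exact: polarInverseK.
split; rewrite ?Pa //; split.
- split; [exact: polP| |exact: ((seteqP _ _).1 img).2].
  move=> e f /set_mem Pe /set_mem Pf ef.
  by rewrite -(polarUnitaryK pa Pe) -(polarUnitaryK pa Pf) ef.
- apply: tends_within_continuous => e Pe.
  have polE f : orthReflectionsOf a f ->
      polarUnitary f = f * cstar_sqrt (f * star f).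
    move=> Pf; have [ff _] := (orthReflectionsOfP f pa).1 Pf.
    by have [] := polar_reflection ff (orthReflectionsOf_spos pa Pf).
  have idF := tends_id (orthReflectionsOf a) e.
  have H : tends (within (orthReflectionsOf a) (nbhs (e : normed_space A)))
      (fun f => f * cstar_sqrt (f * star f)) (e * cstar_sqrt (e * star e)).
    apply: tends_mul => //; apply: tends_sqrt.
    + exact: orthReflectionsOf_spos Pe.
    + by apply: nearW => f; rewrite starM starK.
    + by apply: tends_mul => //; exact: tends_star.
  move=> d /H; rewrite !near_withinE; apply: filterS => f h Pf.
  by rewrite !polE //; exact: h.
- exists (polarInverse a); split.
  + by move=> e /set_mem; exact: polarUnitaryK.
  + by move=> u /set_mem; exact: polarInverseK.
  apply: tends_within_continuous => u Pu.
  set b := cstar_sqrt a; have [pb _] := cstar_sqrt_spos pa.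
  have sb := spos_sa pb.
  pose F := within (orthReflections A) (nbhs (u : normed_space A)).
  have FF : Filter F by apply: within_filter; exact: nbhs_filter.
  have idF : tends F (fun v => v) u := tends_id (orthReflections A) (u : A).
  have cst (l : A) : tends F (fun=> l) l by exact: tends_cst.
  have bub : tends F
      (fun v => b * v * b) (b * u * b).
    exact: (tends_mul (tends_mul (cst b) idF) (cst b)).
  have [su uu] := (orthReflectionP u).1 Pu.
  suff H : tends F
      (fun v => cstar_sqrt ((b * v * b) ^+ 2)) (cstar_sqrt ((b * u * b) ^+ 2)).
    exact: (tends_mul (tends_mul (tends_mul (cst _) H) (cst _)) idF).
  apply: tends_sqrt.
  + apply: spos_sqr_unit; first by rewrite !starM sb su mulrA.
    have ub := spos_unit pb; rewrite unitrMl // unitrMl //.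
    by case: Pu => [[]].
  + rewrite near_withinE; apply: nearW => v Pv.
    have [sv _] := (orthReflectionP (v : A)).1 Pv.
    by rewrite star_sqr !starM sb sv mulrA.
  + exact: tends_mul.
Qed.
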